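(* Let $\lambda,\mu>0$ and let $\{R(t);t\ge0\}$ be the birth-death process on $\{0,1,2,\ldots\}$ with $0$ reflecting, with rate $\lambda$ from state $0$ to state $1$, rate $\lambda$ from each even state $2n\ge2$ to each of its two neighbours, and rate $\mu$ from each odd state to each of its two neighbours. Let $q_{k,n}(t)=P\{R(t)=n\mid R(0)=k\}$ and $P_k(t)=P\{R(t)\text{ even}\mid R(0)=k\}=\sum_{n=0}^{+\infty}q_{k,2n}(t)$. Then for all $t\ge0$ and every initial state $k\in\{0,1,2,\ldots\}$, $$E[R(t)\mid R(0)=k]=\lambda\int_0^t q_{k,0}(\tau)\,d\tau+k,$$ $$\mathrm{Var}[R(t)\mid R(0)=k]=2(\lambda-\mu)\int_0^tP_k(\tau)\,d\tau-\lambda(2k+1)\int_0^tq_{k,0}(\tau)\,d\tau-\lambda^2\left[\int_0^tq_{k,0}(\tau)\,d\tau\right]^2+2\mu t,$$ where $$P_k(t)=\frac{2\mu}{\lambda+\mu}+\frac{\lambda-\mu}{\lambda+\mu}\,e^{-2(\lambda+\mu)t}+\lambda\int_0^te^{-2(\lambda+\mu)(t-\tau)}q_{k,0}(\tau)\,d\tau.$$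
   Context: $\{R(t);t\ge0\}$ is a time-homogeneous continuous-time Markov chain on $\{0,1,2,\ldots\}$; its transition probabilities $q_{k,n}(t)$ satisfy, for $n=1,2,\ldots$ and $t\ge0$, $$\frac{d}{dt}q_{k,0}(t)=\mu q_{k,1}(t)-\lambda q_{k,0}(t),$$ $$\frac{d}{dt}q_{k,2n}(t)=\mu q_{k,2n-1}(t)-2\lambda q_{k,2n}(t)+\mu q_{k,2n+1}(t),$$ $$\frac{d}{dt}q_{k,2n-1}(t)=\lambda q_{k,2n}(t)-2\mu q_{k,2n-1}(t)+\lambda q_{k,2n-2}(t),$$ with $q_{k,n}(0)=\delta_{n,k}$ (Kronecker delta).
   Formalization: The printed formula for P_k(t) is false (it gives P_1(0)=1, but P_1(0)=0); proved instead: P_k(t) = (1/2){2μ/(λ+μ) + [(λ−μ)/(λ+μ) + (−1)^k] e^{−2(λ+μ)t}} + the same integral term. *)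

(* Defs.v *)
From HB Require Import structures.
From mathcomp Require Export all_boot all_order all_algebra.
From mathcomp Require Export all_classical all_reals all_analysis.
Export Order.TTheory GRing.Theory Num.Theory.
Export numFieldNormedType.Exports.

Set Implicit Arguments.
Unset Strict Implicit.
Unset Printing Implicit Defensive.

Local Open Scope classical_set_scope.
Local Open Scope ring_scope.

(* Derivative relative to the half-line [0, +oo[: two-sided for 0 < t,
   right-sided at t = 0. *)
Definition is_derive_nneg (K : realType) (f : K -> K) (t l : K) : Prop :=
  h^-1 * (f (t + h) - f t) @[h --> within [set h | 0 <= t + h] 0^'] --> l.

(* Values of q at negative times are never constrained. *)
Record transition_function (K : realType) (q : nat -> nat -> K -> K) : Prop := {
  tf_ge0 : forall k n t, 0 <= t -> 0 <= q k n t ;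
  tf_sum1 : forall k t, 0 <= t -> (\sum_(0 <= n <oo) (q k n t)%:E = 1)%E ;
  tf_init : forall k n, q k n 0 = (n == k)%:R ;
  tf_chapman_kolmogorov : forall k n s t, 0 <= s -> 0 <= t ->
    ((q k n (s + t))%:E = \sum_(0 <= j <oo) (q k j s * q j n t)%:E)%E }.

(* Forward Kolmogorov equations of the birth-death chain reflected at 0 that
   jumps to each neighbour at rate lam from even states and mu from odd states.
   At t = 0, together with q k n 0 = (n == k), they say that the right
   derivatives of q at 0 are the jump rates. *)
Record forward_equations (K : realType) (lam mu : K)
    (q : nat -> nat -> K -> K) : Prop := {
  fe_zero : forall k t, 0 <= t ->
    is_derive_nneg (q k 0) t (mu * q k 1 t - lam * q k 0 t) ;
  fe_even : forall k n t, (0 < n)%N -> 0 <= t ->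
    is_derive_nneg (q k n.*2) t
      (mu * q k n.*2.-1 t - 2 * lam * q k n.*2 t + mu * q k n.*2.+1 t) ;
  fe_odd : forall k n t, (0 < n)%N -> 0 <= t ->
    is_derive_nneg (q k n.*2.-1) t
      (lam * q k n.*2 t - 2 * mu * q k n.*2.-1 t + lam * q k n.*2.-2 t) }.

(* The Markov property with stationary transition function q, multiplied out by
   the probability of the past so that null pasts need no separate treatment.
   Times are arbitrary instants 0 <= s 0 <= ... <= s m.+1; the values of X at
   negative times play no role. *)
Definition markov_chain d (T : measurableType d) (K : realType)
    (P : probability T K) (X : K -> {RV P >-> nat})
    (q : nat -> nat -> K -> K) : Prop :=
  forall (m : nat) (s : nat -> K) (i : nat -> nat),
    0 <= s 0 -> {homo s : a b / (a <= b)%N >-> a <= b} ->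
    (P (\bigcap_(j in [set j | (j <= m.+1)%N]) (X (s j) @^-1` [set i j])) =
     P (\bigcap_(j in [set j | (j <= m)%N]) (X (s j) @^-1` [set i j])) *
       (q (i m) (i m.+1) (s m.+1 - s m))%:E)%E.

Record alternating_birth_death d (T : measurableType d) (K : realType)
    (lam mu : K) (P : probability T K) (X : K -> {RV P >-> nat})
    (q : nat -> nat -> K -> K) : Prop := {
  abd_transition : transition_function q ;
  abd_forward : forward_equations lam mu q ;
  abd_markov : markov_chain X q }.

Lemma measurable_fiber d (T : measurableType d) (K : realType)
    (P : probability T K) (Y : {RV P >-> nat}) (k : nat) :
  measurable (Y @^-1` [set k]).
Proof. exact: measurable_funPTI. Qed.

(* The law P(. | Y = k). When P(Y = k) = 0 the library's normalization falls
   back on its second argument, here P itself. *)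
Definition cond_law d (T : measurableType d) (K : realType)
    (P : probability T K) (Y : {RV P >-> nat}) (k : nat) : probability T K :=
  mnormalize (mrestr P (measurable_fiber Y k)) P.

(* Main.v *)
(* Write Q_n for q k n, r_n for the jump rate out of n (to each neighbour), and
   T_N = 1 - sum_{n < N} Q_n = P(R >= N). The forward equations say that T_N'
   is the net flow r_{N-1} Q_{N-1} - r_N Q_N across the edge (N-1, N), so the
   truncated moments
     E[min(R, N)]   = sum_{m < N} T_{m+1},
     E[min(R, N)^2] = sum_{m < N} (2m + 1) T_{m+1}
   are finite sums whose derivatives telescope, up to a boundary term of order
   N Q_N. Since sum_{n < N} n Q_n <= E[min(R, N)] <= k + lam t, this boundary
   term tends to 0 boundedly on compact time intervals, and dominated
   convergence yields the two moments as N tends to infinity. The parity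
   probability solves P' = -2 (lam + mu) P + 2 mu + lam Q_0, again obtained by
   truncating the sum over even states and passing to the limit after
   multiplication by the integrating factor. *)
Require Import Defs.
From mathcomp Require Import measurable_realfun.
From mathcomp Require Import ring lra zify.

Set Implicit Arguments.
Unset Strict Implicit.
Unset Printing Implicit Defensive.

Local Open Scope classical_set_scope.
Local Open Scope ring_scope.

(** * Integration over compact intervals of the half-line *)

Section real_integrals.
Context {K : realType}.
Notation mu := (@lebesgue_measure K).
Implicit Types (f F g : K -> K) (t : K).

Lemma continuous_integrable_itv f t : continuous f ->
  mu.-integrable `[0, t] (EFin \o f).
Proof.
move=> cf; apply: continuous_compact_integrable; first exact: segment_compact.
exact: continuous_subspaceT.
Qed.

Lemma integrable_itv_scale f t (c : K) : mu.-integrable `[0, t] (EFin \o f) ->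
  mu.-integrable `[0, t] (EFin \o (fun x => c * f x)).
Proof.
by move=> fi; apply: (@integrableZl _ (measurableTypeR K) _ _ _ _ c _ fi).
Qed.

Lemma Rintegral_itv_cst (c : K) t : 0 <= t ->
  \int[mu]_(x in `[0, t]) cst c x = c * t.
Proof.
rewrite le_eqVlt => /predU1P[<-|t0].
  by rewrite set_itv1 Rintegral_set1 mulr0.
by rewrite Rintegral_cst//= lebesgue_measure_itv/= lte_fin t0 oppr0 adde0.
Qed.

Lemma continuous_expR_scale (c : K) : continuous (fun x : K => expR (c * x)).
Proof.
move=> x; apply: continuous_comp; first exact: mulrl_continuous.
exact: continuous_expR.
Qed.

(** Integrating factor: when [dF] has the form [s - c * F x], the bracket collapses to the source
    [s]. *)
Lemma is_derive_expR_mul (c : K) F (x dF : K) : is_derive x 1 F dF ->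
  is_derive x 1 (fun y => expR (c * y) * F y) (expR (c * x) * (c * F x + dF)).
Proof.
move=> dFx.
have dE : is_derive x 1 (fun y : K => expR (c * y)) (expR (c * x) * c).
  apply: (is_derive1_comp (f := expR) (g := *%R c)).
  by apply: is_derive_eq; rewrite /GRing.scale/= mulr1.
have /is_derive_eq := is_deriveM dE dFx; apply.
by rewrite /GRing.scale/=; ring.
Qed.

(** Two-sided derivatives are asked only at positive times, since the forward equations are
    one-sided at 0; continuity of [F] carries the fundamental theorem down to the endpoint. *)
Lemma Rintegral_itv_pos_derive f F t : continuous f -> continuous F ->
    (forall x : K, 0 < x -> is_derive x 1 F (f x)) -> 0 <= t ->
  \int[mu]_(x in `[0, t]) f x = F t - F 0.
Proof.
move=> cf cF dF; rewrite le_eqVlt => /predU1P[<-|t0].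
  by rewrite set_itv1 Rintegral_set1 subrr.
rewrite /Rintegral (@continuous_FTC2 _ f F)//.
- exact: continuous_subspaceT.
- split => [x| |].
  + by rewrite in_itv/= => /andP[x0 _]; have [] := dF x x0.
  + exact: cvg_at_right_filter (cF 0).
  + exact: cvg_at_left_filter (cF t).
- move=> x; rewrite in_itv/= => /andP[x0 _].
  by rewrite derive1E; have [_] := dF x x0.
Qed.

(** Dominated convergence with a constant dominating function, integrable because the interval is
    compact. The first conclusion supplies integrability of limits whose continuity is unknown. *)
Lemma bounded_cvg_Rintegral (f_ : nat -> K -> K) g t (M : K) :
    (forall n, continuous (f_ n)) ->
    (forall n x, 0 <= x <= t -> `|f_ n x| <= M) ->
    (forall x, 0 <= x <= t -> f_ n x @[n --> \oo] --> g x) ->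
  mu.-integrable `[0, t] (EFin \o g) /\
  \int[mu]_(x in `[0, t]) f_ n x @[n --> \oo] --> \int[mu]_(x in `[0, t]) g x.
Proof.
move=> cf fM fg.
have mf n := measurable_int _ (continuous_integrable_itv t (cf n)).
have fgE (x : K) : [set` `[0, t]] x ->
    (EFin \o f_ n) x @[n --> \oo] --> (EFin \o g) x.
  by rewrite /= in_itv/= => xt; apply: cvg_EFin; [exact: nearW|exact: fg].
have mg := emeasurable_fun_cvg _ _ mf fgE.
have iM := @continuous_integrable_itv (cst M) t (@cst_continuous _ _ M).
have fM' (x : K) n : [set` `[0, t]] x ->
    (`|(EFin \o f_ n) x| <= (EFin \o cst M) x)%E.
  by rewrite /= in_itv/= => xt; rewrite lee_fin fM.
have [ig _ cvgI] := @dominated_convergence _ (measurableTypeR K) K mu `[0, t]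
  (measurable_itv _) (fun n => EFin \o f_ n) (EFin \o g) (EFin \o cst M)
  mf mg (aeW mu fgE) iM (aeW mu fM').
split=> //; apply: fine_cvg; rewrite fineK//; exact: integrable_fin_num.
Qed.

End real_integrals.

(** * Derivatives and continuity of finite sums *)

Section finite_sums_of_functions.
Context {K : realType}.
Implicit Types (f : nat -> K -> K).

Lemma is_derive_sum_nat f (df : nat -> K) n (x : K) :
    (forall i, is_derive x 1 (f i) (df i)) ->
  is_derive x 1 (fun t => \sum_(0 <= i < n) f i t) (\sum_(0 <= i < n) df i).
Proof.
move=> dfx; elim: n => [|n IH].
  under eq_fun do rewrite big_nil; rewrite big_nil; exact: is_derive_cst.
under eq_fun do rewrite big_nat_recr//=; rewrite big_nat_recr//=.
exact: is_deriveD.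
Qed.

Lemma continuous_sum_nat f n : (forall i, continuous (f i)) ->
  continuous (fun t => \sum_(0 <= i < n) f i t).
Proof.
by move=> cf x; apply: cvg_big => [|i _]; [exact: add_continuous|exact: cf].
Qed.

End finite_sums_of_functions.

(** The first [N.*2.+1] states contain exactly the even states 0, 2, ..., 2N; parity sums are
    truncated along this subsequence. *)
Lemma double_succ_cvgy : N.*2.+1 @[N --> \oo] --> \oo.
Proof. by apply/cvgnyPge => A; exists A => // N /= AN; lia. Qed.

(** * Truncated moments for a solution of the forward equations *)

Section tail_moments.
Context {K : realType}.
Variables (lam mu : K) (k : nat) (Q : nat -> K -> K).
Hypotheses (lam_gt0 : 0 < lam) (mu_gt0 : 0 < mu).

Definition rate (m : nat) : K := if odd m then mu else lam.

(** Net flow across the edge from [m - 1] to [m]. The value 0 at [m = 0] encodes reflection, so that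
    one equation covers all states. *)
Definition flux (m : nat) (t : K) : K :=
  if m is m'.+1 then rate m' * Q m' t - rate m * Q m t else 0.

Definition tail (N : nat) (t : K) : K := 1 - \sum_(0 <= n < N) Q n t.

Definition moment1 (N : nat) (t : K) : K := \sum_(0 <= m < N) tail m.+1 t.

Definition moment2 (N : nat) (t : K) : K :=
  \sum_(0 <= m < N) (2 * m%:R + 1) * tail m.+1 t.

Definition even_mass (N : nat) (t : K) : K := \sum_(0 <= n < N.+1) Q n.*2 t.

Hypothesis cQ : forall n, continuous (Q n).
Hypothesis dQ : forall n (t : K), 0 < t ->
  is_derive t 1 (Q n) (flux n t - flux n.+1 t).
Hypothesis Q_ge0 : forall n t, 0 <= Q n t.
Hypothesis sumQ : forall t, \sum_(0 <= n < N) Q n t @[N --> \oo] --> (1 : K).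
Hypothesis Q_init : forall n, Q n 0 = (n == k)%:R.

Lemma rate_gt0 m : 0 < rate m. Proof. by rewrite /rate; case: ifP. Qed.

Lemma rate_le m : rate m <= lam + mu.
Proof.
by rewrite /rate; case: ifP => _; [rewrite lerDr|rewrite lerDl]; exact: ltW.
Qed.

Lemma tail_ge0 N t : 0 <= tail N t.
Proof.
rewrite subr_ge0 -(cvg_lim (@Rhausdorff _) (sumQ t)).
apply: (nondecreasing_cvgn_le (u_ := fun N => \sum_(0 <= n < N) Q n t)).
  by apply/nondecreasing_seqP => n; rewrite big_nat_recr//= lerDl.
exact: cvgP (sumQ t).
Qed.

(** The difference is [tail N.+1 t]. *)
Lemma Q_le_tail N t : Q N t <= tail N t.
Proof.
rewrite -subr_ge0 -[_ - _]/(1 - _ - _) -addrA -opprD -big_nat_recr//=.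
exact: tail_ge0.
Qed.

Lemma tail_le1 N t : tail N t <= 1.
Proof. by rewrite gerBl; exact: sumr_ge0. Qed.

Lemma Q_le1 N t : Q N t <= 1.
Proof. exact: le_trans (Q_le_tail N t) (tail_le1 N t). Qed.

Lemma tail_init N : tail N 0 = (N <= k)%:R.
Proof.
rewrite /tail; elim: N => [|N IH]; first by rewrite big_nil subr0.
rewrite big_nat_recr//= opprD addrA IH Q_init.
by rewrite leq_eqVlt; case: eqP => [->|_]; rewrite ?ltnn ?subrr ?subr0.
Qed.

Lemma continuous_tail N : continuous (tail N).
Proof.
move=> x; apply: cvgB; first exact: cvg_cst.
exact: continuous_sum_nat.
Qed.

(** The sum of flux differences telescopes, and [flux 0] vanishes. *)
Lemma tail_derive N (t : K) : 0 < t -> is_derive t 1 (tail N) (flux N t).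
Proof.
move=> t0; have dS := is_derive_sum_nat N (fun n => dQ n t0).
have -> : flux N t = 0 - \sum_(0 <= n < N) (flux n t - flux n.+1 t).
  under eq_bigr do rewrite -opprB.
  by rewrite sumrN telescope_sumr// opprK add0r subr0.
exact: is_deriveB.
Qed.

Lemma sum_flux N t :
  \sum_(0 <= m < N) flux m.+1 t = lam * Q 0 t - rate N * Q N t.
Proof.
elim: N => [|N IH]; first by rewrite big_nil subrr.
by rewrite big_nat_recr//= IH addrA subrK.
Qed.

(** Result of summation by parts on the flux weighted by [2m + 1]: consecutive weights differ by 2,
    the correction at state 0 is [lam * Q 0], and the last term is the boundary flow out of the
    truncation. *)
Definition moment2_drift (N : nat) (x : K) : K :=
  2 * (\sum_(0 <= m < N) rate m * Q m x) - lam * Q 0 x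
    - (2 * N%:R - 1) * (rate N * Q N x).

Lemma sum_weighted_flux N t :
  \sum_(0 <= m < N) (2 * m%:R + 1) * flux m.+1 t = moment2_drift N t.
Proof.
rewrite /moment2_drift; elim: N => [|N IH].
  by rewrite !big_nil /rate /=; ring.
by rewrite big_nat_recr//= IH [in RHS]big_nat_recr//= -natr1; ring.
Qed.

Lemma moment1_init N : moment1 N 0 = (minn N k)%:R.
Proof.
rewrite /moment1; elim: N => [|N IH]; first by rewrite big_nil min0n.
by rewrite big_nat_recr//= IH tail_init -natrD; congr _%:R; lia.
Qed.

Lemma moment2_init N : moment2 N 0 = (minn N k)%:R ^+ 2.
Proof.
rewrite /moment2; elim: N => [|N IH]; first by rewrite big_nil min0n expr0n.
rewrite big_nat_recr//= IH tail_init; have [Nk|kN] := ltnP N k.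
  by rewrite (minn_idPl Nk) -natr1 mulr1n; ring.
by rewrite mulr0 addr0 (minn_idPr _)// ltnW.
Qed.

Lemma moment1_integral N t : 0 <= t ->
  moment1 N t = (minn N k)%:R +
    \int[lebesgue_measure]_(x in `[0, t]) (lam * Q 0 x - rate N * Q N x).
Proof.
move=> t0; rewrite -moment1_init addrC; apply/eqP; rewrite -subr_eq; apply/eqP.
apply/esym/Rintegral_itv_pos_derive => //.
- by move=> x; apply: cvgB; apply: cvgMr; exact: cQ.
- by apply: continuous_sum_nat => m; exact: continuous_tail.
- move=> x x0; rewrite -sum_flux.
  by apply: is_derive_sum_nat => m; exact: tail_derive.
Qed.

Lemma continuous_rateQ m : continuous (fun x => rate m * Q m x).
Proof. by move=> x; apply: cvgMr; exact: cQ. Qed.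

Lemma continuous_moment2_drift N : continuous (moment2_drift N).
Proof.
move=> x; apply: cvgB; last by apply: cvgMr; exact: continuous_rateQ.
apply: cvgB; last by apply: cvgMr; exact: cQ.
apply: cvgMr; apply: continuous_sum_nat; exact: continuous_rateQ.
Qed.

Lemma moment2_integral N t : 0 <= t ->
  moment2 N t = (minn N k)%:R ^+ 2 +
    \int[lebesgue_measure]_(x in `[0, t]) moment2_drift N x.
Proof.
move=> t0; rewrite -moment2_init addrC; apply/eqP; rewrite -subr_eq; apply/eqP.
apply/esym/Rintegral_itv_pos_derive => //.
- exact: continuous_moment2_drift.
- apply: continuous_sum_nat => m x; apply: cvgMr; exact: continuous_tail.
- move=> x x0; rewrite -sum_weighted_flux.
  apply: is_derive_sum_nat => m.
  by have := tail_derive m.+1 x0; move/is_deriveZ; exact.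
Qed.

(** Abel summation back from tails to point masses; it turns a bound on [moment1] into one on the
    partial sums of the mean. *)
Lemma moment1E N t :
  moment1 N t = \sum_(0 <= n < N) n%:R * Q n t + N%:R * tail N t.
Proof.
rewrite /moment1; elim: N => [|N IH]; first by rewrite !big_nil mul0r addr0.
by rewrite !big_nat_recr//= IH /tail big_nat_recr//= -natr1; ring.
Qed.
Lemma moment1_le N t : 0 <= t -> moment1 N t <= k%:R + lam * t.
Proof.
move=> t0; rewrite moment1_integral//; apply: lerD.
  by rewrite ler_nat geq_minr.
have -> : lam * t = \int[lebesgue_measure]_(x in `[0, t]) (cst lam x).
  by rewrite Rintegral_itv_cst.
apply: le_Rintegral => //.
- apply: continuous_integrable_itv => x.
  by apply: cvgB; apply: cvgMr; exact: cQ.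
- exact/continuous_integrable_itv/cst_continuous.
(* The boundary term is dropped by sign, and [Q 0] is at most 1. *)
- move=> x _ /=; rewrite lerBlDr; apply: ler_wpDr.
    by rewrite mulr_ge0// ltW// rate_gt0.
  by rewrite ler_piMr ?Q_le1// ltW.
Qed.

Lemma sum_natQ_le N t : 0 <= t ->
  \sum_(0 <= n < N) n%:R * Q n t <= k%:R + lam * t.
Proof.
move=> t0; apply: le_trans (moment1_le N t0).
by rewrite moment1E lerDl mulr_ge0// tail_ge0.
Qed.

Lemma natQ_le N t : 0 <= t -> N%:R * Q N t <= k%:R + lam * t.
Proof.
move=> t0; apply: le_trans (sum_natQ_le N.+1 t0).
by rewrite big_nat_recr//= lerDr sumr_ge0// => i _; rewrite mulr_ge0.
Qed.

(** These are the terms of a nonnegative series with bounded partial sums. This removes the boundary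
    term of the second moment, whose coefficient grows linearly in [N]. *)
Lemma natQ_cvg0 t : 0 <= t -> N%:R * Q N t @[N --> \oo] --> (0 : K).
Proof.
move=> t0; apply: (@cvg_series_cvg_0 _ _ (fun N => N%:R * Q N t)).
apply: nondecreasing_is_cvgn.
  by apply/nondecreasing_seqP => n; rewrite seriesSr lerDl mulr_ge0.
exists (k%:R + lam * t) => _ [N _ <-]; exact: sum_natQ_le.
Qed.

Lemma Q_cvg0 t : Q N t @[N --> \oo] --> (0 : K).
Proof. by apply: (@cvg_series_cvg_0 _ _ (Q^~ t)); apply: cvgP (sumQ t). Qed.

Lemma rateQ_le m t : `|rate m * Q m t| <= lam + mu.
Proof.
rewrite ger0_norm; last by rewrite mulr_ge0// ltW// rate_gt0.
by apply: le_trans (rate_le m); rewrite ler_piMr ?Q_le1// ltW// rate_gt0.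
Qed.

Lemma lamQ0_le t : `|lam * Q 0 t| <= lam.
Proof. by rewrite ger0_norm ?mulr_ge0 ?ler_piMr ?Q_le1// ltW. Qed.

(** The rates alternate and may have no limit, so the product is squeezed using their bound
    [lam + mu]. *)
Lemma rate_mul_cvg0 (u : nat -> K) : u @ \oo --> (0 : K) ->
  rate N * u N @[N --> \oo] --> (0 : K).
Proof.
move=> u0; apply/norm_cvg0P.
have lu : (lam + mu) * `|u N| @[N --> \oo] --> (0 : K).
  by rewrite -[X in _ --> X](mulr0 (lam + mu)); apply: cvgMr; apply/norm_cvg0P.
apply: squeeze_cvgr lu; last exact: cvg_cst.
apply: nearW => N; rewrite normr_ge0/= normrM ler_wpM2r//.
by rewrite gtr0_norm ?rate_gt0 ?rate_le.
Qed.

Lemma minn_cvg : (minn N k)%:R @[N --> \oo] --> (k%:R : K).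
Proof.
apply: cvg_near_cst; exists k => // N /= kN; by rewrite (minn_idPr kN).
Qed.

Lemma moment1_cvg t : 0 <= t ->
  moment1 N t @[N --> \oo] -->
    k%:R + lam * \int[lebesgue_measure]_(x in `[0, t]) Q 0 x.
Proof.
move=> t0; under eq_fun do rewrite moment1_integral//.
apply: cvgD; first exact: minn_cvg.
rewrite -RintegralZl//; last exact: continuous_integrable_itv.
(* [lam] bounds the flow out of 0 and [lam + mu] the boundary term. *)
apply: (bounded_cvg_Rintegral (M := lam + (lam + mu)) _ _ _).2
  => [N x|N x _|x _].
- by apply: cvgB; apply: cvgMr; exact: cQ.
- by rewrite (le_trans (ler_normB _ _))// lerD ?lamQ0_le ?rateQ_le.
- rewrite -[X in _ --> X]subr0; apply: cvgB; first exact: cvg_cst.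
  by apply: rate_mul_cvg0; exact: Q_cvg0.
Qed.
Lemma sum_rateQ_le N t : \sum_(0 <= m < N) rate m * Q m t <= lam + mu.
Proof.
apply: (@le_trans _ _ (\sum_(0 <= m < N) (lam + mu) * Q m t)).
  by apply: ler_sum => m _; rewrite ler_wpM2r// rate_le.
rewrite -mulr_sumr ler_piMr ?addr_ge0 ?(ltW lam_gt0) ?(ltW mu_gt0)//.
by rewrite -subr_ge0; exact: tail_ge0.
Qed.

(** Every rate is [mu], plus an excess [lam - mu] on even states. This is how the parity probability
    enters the variance. *)
Lemma sum_rateQ N t : \sum_(0 <= m < N.*2.+1) rate m * Q m t =
  mu * \sum_(0 <= m < N.*2.+1) Q m t + (lam - mu) * even_mass N t.
Proof.
rewrite /even_mass; elim: N => [|N IH].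
  by rewrite !big_nat1 /rate /=; ring.
rewrite (big_nat_recr N.+1)//= doubleS !(big_nat_recr N.*2.+2)//=.
rewrite !(big_nat_recr N.*2.+1)//= IH.
by rewrite /rate /= odd_double /=; ring.
Qed.

Variable Pe : K -> K.
Hypothesis Pe_cvg : forall t, 0 <= t -> even_mass N t @[N --> \oo] --> Pe t.

Lemma even_mass_ge0 N t : 0 <= even_mass N t.
Proof. exact: sumr_ge0. Qed.

Lemma even_mass_le1 N t : even_mass N t <= 1.
Proof.
suff /le_trans : even_mass N t <= \sum_(0 <= m < N.*2.+1) Q m t.
  by apply; rewrite -subr_ge0; exact: tail_ge0.
rewrite /even_mass; elim: N => [|N IH]; first by rewrite !big_nat1.
rewrite (big_nat_recr N.+1)//= doubleS (big_nat_recr N.*2.+2)//=.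
by rewrite (big_nat_recr N.*2.+1)//= lerD2r (le_trans IH)// lerDl.
Qed.

Lemma integrable_even_prob t : 0 <= t ->
  lebesgue_measure.-integrable `[0, t] (EFin \o Pe).
Proof.
move=> t0; apply: (bounded_cvg_Rintegral (f_ := even_mass) (M := 1) _ _ _).1.
- by move=> N; apply: continuous_sum_nat => n; exact: cQ.
- by move=> N x _; rewrite ger0_norm ?even_mass_ge0 ?even_mass_le1.
- by move=> x /andP[x0 _]; exact: Pe_cvg.
Qed.

(** Along odd truncations the drift tends to [2 * (mu + (lam - mu) * Pe) - lam * Q 0], which is then
    integrated. *)
Lemma moment2_cvg t : 0 <= t ->
  moment2 N.*2.+1 t @[N --> \oo] -->
    k%:R ^+ 2 + (2 * (lam - mu) * (\int[lebesgue_measure]_(x in `[0, t]) Pe x)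
    + 2 * mu * t - lam * \int[lebesgue_measure]_(x in `[0, t]) Q 0 x).
Proof.
move=> t0; under eq_fun do rewrite moment2_integral//.
apply: cvgD.
  have := cvg_comp _ _ double_succ_cvgy minn_cvg.
  by move=> ck; rewrite expr2; under eq_fun do rewrite expr2; exact: cvgM.
have iPe := integrable_even_prob t0.
have iQ := continuous_integrable_itv t (@cQ 0%N).
have -> : 2 * (lam - mu) * (\int[lebesgue_measure]_(x in `[0, t]) Pe x)
    + 2 * mu * t - lam * (\int[lebesgue_measure]_(x in `[0, t]) Q 0 x) =
    \int[lebesgue_measure]_(x in `[0, t])
      (2 * (lam - mu) * Pe x + cst (2 * mu) x - lam * Q 0 x).
  have ic := continuous_integrable_itv t (@cst_continuous _ _ (2 * mu)).
  rewrite RintegralB//; last exact: integrable_itv_scale; last first.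
    exact: integrableD (integrable_itv_scale _ iPe) ic.
  rewrite RintegralD//; last exact: integrable_itv_scale.
  by rewrite Rintegral_itv_cst// !RintegralZl.
(* The three summands of [M] bound the three terms of the drift; in the last, [(2n - 1) Q_n] is at
   most [2 n Q_n + 1] in absolute value, and [n Q_n] is at most [k + lam * t]. *)
apply: (bounded_cvg_Rintegral (f_ := fun N => moment2_drift N.*2.+1)
  (M := 2 * (lam + mu) + lam + (2 * (k%:R + lam * t) + 1) * (lam + mu))
  _ _ _).2.
- by move=> N; exact: continuous_moment2_drift.
- move=> N x /andP[x0 xt]; move: (N.*2.+1) => n.
  rewrite (le_trans (ler_normB _ _))// lerD//.
    rewrite (le_trans (ler_normB _ _))// lerD ?lamQ0_le//.
    rewrite ger0_norm ?ler_pM2l ?sum_rateQ_le// mulr_ge0// sumr_ge0// => i _.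
    by rewrite mulr_ge0// ltW// rate_gt0.
  rewrite mulrCA normrM mulrC ler_pM ?normr_ge0//; last first.
    by rewrite gtr0_norm ?rate_gt0 ?rate_le.
  have Mx : n%:R * Q n x <= k%:R + lam * t.
    by rewrite (le_trans (natQ_le n x0))// lerD2l ler_pM2l.
  have Q1 := Q_le1 n x; have Qn0 := Q_ge0 n x.
  have nQ0 : 0 <= n%:R * Q n x by rewrite mulr_ge0.
  by rewrite ler_norml; apply/andP; split; lra.
- move=> x /andP[x0 _].
  (* The 1 is the limit of the total mass and the 0 that of the boundary term. *)
  have -> : 2 * (lam - mu) * Pe x + cst (2 * mu) x - lam * Q 0 x =
      2 * (mu * 1 + (lam - mu) * Pe x) - lam * Q 0 x - 0 by rewrite /=; ring.
  apply: cvgB.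
    apply: cvgB; last exact: cvg_cst.
    apply: cvgMr; under eq_fun do rewrite sum_rateQ.
    apply: cvgD; apply: cvgMr; last exact: Pe_cvg.
    exact: cvg_comp double_succ_cvgy (sumQ x).
  apply: (cvg_comp (fun N => N.*2.+1)
    (fun n => (2 * n%:R - 1) * (rate n * Q n x)) double_succ_cvgy).
  under eq_fun do rewrite mulrCA.
  apply: rate_mul_cvg0.
  rewrite -[X in _ --> X](subr0 0) -[X in _ --> X - _](mulr0 2).
  under eq_fun do rewrite mulrBl mul1r -mulrA.
  by apply: cvgB; [apply: cvgMr; exact: natQ_cvg0|exact: Q_cvg0].
Qed.

(** * The linear differential equation for the parity probability *)

Let c : K := 2 * (lam + mu).

(** Truncated form of [2 * mu + lam * Q 0]. The term in [Q 0] corrects for state 0 having one exit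
    instead of two; the last term is the inflow from state [N.*2.+1], which vanishes in the
    limit. *)
Let even_source N x : K :=
  2 * mu * (\sum_(0 <= m < N.*2.+1) Q m x) + lam * Q 0 x + mu * Q N.*2.+1 x.

(** Odd states below [N.*2] feed even states at total rate [2 * mu], and their mass is the total
    truncated mass minus the even one. *)
Lemma even_mass_derive N (t : K) : 0 < t -> is_derive t 1 (even_mass N)
  (even_source N t - c * even_mass N t).
Proof.
move=> t0; apply: is_derive_eq.
  exact: is_derive_sum_nat (fun n => dQ n.*2 t0).
rewrite /even_source /c /even_mass; elim: N => [|N IH].
  by rewrite !big_nat1 /flux /rate /=; ring.
rewrite (big_nat_recr N.+1)//= IH doubleS.
rewrite (big_nat_recr N.*2.+2)//= (big_nat_recr N.*2.+1)//=.
rewrite (big_nat_recr N.+1)//=.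
by rewrite /rate /= odd_double /= doubleS; ring.
Qed.

Lemma even_mass_init N : (k <= N.*2)%N -> even_mass N 0 = (~~ odd k)%:R.
Proof.
have -> : even_mass N 0 = (~~ odd k && (k <= N.*2)%N)%:R.
  rewrite /even_mass; elim: N => [|N IH].
    by rewrite big_nat1 Q_init; congr _%:R; lia.
  by rewrite big_nat_recr//= IH Q_init -natrD; congr _%:R; lia.
by move=> ->; rewrite andbT.
Qed.

(** The integrated form of the truncated equation passes to the limit, so [Pe] itself is never
    differentiated. *)
Lemma expR_even_prob t : 0 <= t ->
  expR (c * t) * Pe t = (~~ odd k)%:R +
  \int[lebesgue_measure]_(x in `[0, t])
    (expR (c * x) * (2 * mu + lam * Q 0 x)).
Proof.
move=> t0; pose f N (x : K) := expR (c * x) * even_source N x.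
have csource N : continuous (even_source N).
  move=> x; apply: cvgD; last by apply: cvgMr; exact: cQ.
  apply: cvgD; last by apply: cvgMr; exact: cQ.
  by apply: cvgMr; apply: continuous_sum_nat.
have cf N : continuous (f N).
  by move=> x; apply: cvgM; [exact: continuous_expR_scale|exact: csource].
have fE N : \int[lebesgue_measure]_(x in `[0, t]) f N x =
    expR (c * t) * even_mass N t - even_mass N 0.
  have cF : continuous (fun x => expR (c * x) * even_mass N x).
    move=> x; apply: cvgM; first exact: continuous_expR_scale.
    by apply: continuous_sum_nat => n; exact: cQ.
  have dF (x : K) : 0 < x ->
      is_derive x 1 (fun x => expR (c * x) * even_mass N x) (f N x).
    move=> x0; have := is_derive_expR_mul c (even_mass_derive N x0).
    by rewrite addrC subrK.
  by rewrite (Rintegral_itv_pos_derive (cf N) cF dF t0) mulr0 expR0 mul1r.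
(* On [[0, t]] the exponential is at most its value at [t], and the source is at most
   [2 * mu + lam + mu]. *)
have intf := bounded_cvg_Rintegral (f_ := f) (t := t)
  (g := fun x => expR (c * x) * (2 * mu + lam * Q 0 x))
  (M := expR (c * t) * (2 * mu + lam + mu)) cf.
have lim1 : expR (c * t) * even_mass N t - even_mass N 0 @[N --> \oo] -->
    expR (c * t) * Pe t - (~~ odd k)%:R.
  apply: cvgB; first by apply: cvgMr; exact: Pe_cvg.
  apply: cvg_near_cst; exists k => // N /= kN; apply: even_mass_init; lia.
suff lim2 : \int[lebesgue_measure]_(x in `[0, t]) f N x @[N --> \oo] -->
    \int[lebesgue_measure]_(x in `[0, t])
      (expR (c * x) * (2 * mu + lam * Q 0 x)).
  move: lim2; under eq_fun do rewrite fE.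
  by move=> /(cvg_unique (@Rhausdorff _) lim1) <-; rewrite addrC subrK.
apply: (intf _ _).2 => [N x /andP[x0 xt]|x /andP[x0 _]].
- rewrite normrM ler_pM// ?ger0_norm ?expR_ge0// ?ler_expR.
  + by rewrite ler_pM2l// /c mulr_gt0// addr_gt0.
  + rewrite !lerD//.
    * rewrite ler_piMr ?mulr_ge0 ?(ltW mu_gt0)// -subr_ge0; exact: tail_ge0.
    * by rewrite ler_piMr ?Q_le1// ltW.
    * by rewrite ler_piMr ?Q_le1// ltW.
  + by rewrite !addr_ge0// !mulr_ge0 ?sumr_ge0// ltW.
(* The limit is rewritten as [2 * mu * 1 + lam * Q 0 x + mu * 0] to match the three terms of the
   source. *)
- apply: cvgMr; rewrite -[X in _ --> X]addr0 -[in X in _ --> X](mulr0 mu).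
  rewrite -[in 2 * mu](mulr1 (2 * mu)).
  apply: cvgD; last first.
    by apply: cvgMr; exact: cvg_comp double_succ_cvgy (Q_cvg0 x).
  apply: cvgD; last exact: cvg_cst.
  by apply: cvgMr; exact: cvg_comp double_succ_cvgy (sumQ x).
Qed.

(** Multiplication by [expR (- c * t)] solves for [Pe]; the constant part of the source integrates
    explicitly. *)
Lemma even_prob_formula t : 0 <= t ->
  Pe t = 2^-1 * (2 * mu / (lam + mu)
           + ((lam - mu) / (lam + mu) + (-1) ^+ k)
             * expR (- 2 * (lam + mu) * t))
         + lam * (\int[lebesgue_measure]_(x in `[0, t])
                   (expR (- 2 * (lam + mu) * (t - x)) * Q 0 x)).
Proof.
move=> t0.
have c0 : lam + mu != 0 by rewrite gt_eqF// addr_gt0.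
have cEQ : continuous (fun x => expR (c * x) * Q 0 x).
  by move=> x; apply: cvgM; [exact: continuous_expR_scale|exact: cQ].
have -> : \int[lebesgue_measure]_(x in `[0, t])
    (expR (- 2 * (lam + mu) * (t - x)) * Q 0 x) =
    expR (- c * t) *
      \int[lebesgue_measure]_(x in `[0, t]) (expR (c * x) * Q 0 x).
  rewrite -RintegralZl//; last exact: continuous_integrable_itv cEQ.
  apply: eq_Rintegral => x _; rewrite mulrA -expRD; congr (expR _ * _).
  by rewrite /c; ring.
have /(congr1 ( *%R (expR (- c * t)))) := expR_even_prob t0.
rewrite mulrA -expRD (mulNr c) addNr expR0 mul1r => ->.
have -> : \int[lebesgue_measure]_(x in `[0, t])
    (expR (c * x) * (2 * mu + lam * Q 0 x)) =
    2 * mu / c * (expR (c * t) - 1) +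
    lam * \int[lebesgue_measure]_(x in `[0, t]) (expR (c * x) * Q 0 x).
  have dE : 2 * mu / c * (expR (c * t) - 1) =
      \int[lebesgue_measure]_(x in `[0, t]) (2 * mu * expR (c * x)).
    have cf : continuous (fun x => 2 * mu * expR (c * x)).
      by move=> x; apply: cvgMr; exact: continuous_expR_scale.
    have cF : continuous (fun x => expR (c * x) * cst (2 * mu / c) x).
      move=> x; apply: cvgM; first exact: continuous_expR_scale.
      exact: cvg_cst.
    have dF (x : K) : 0 < x -> is_derive x 1
        (fun x => expR (c * x) * cst (2 * mu / c) x) (2 * mu * expR (c * x)).
      move=> x0; have := is_derive_expR_mul c (is_derive_cst (2 * mu / c) x 1).
      by move/is_derive_eq; apply; rewrite /= /c; field.
    by rewrite (Rintegral_itv_pos_derive cf cF dF t0) mulr0 expR0 /=; ring.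
  rewrite dE -RintegralZl//; last exact: continuous_integrable_itv cEQ.
  rewrite -RintegralD//.
  - apply: eq_Rintegral => x _. rewrite /=. ring.
  - apply: continuous_integrable_itv => x.
    by apply: cvgMr; exact: continuous_expR_scale.
  - by apply: integrable_itv_scale; exact: continuous_integrable_itv.
have -> : - 2 * (lam + mu) * t = - c * t by rewrite /c; ring.
have eK : expR (- (c * t)) * expR (c * t) = 1 by rewrite -expRD addNr expR0.
rewrite mulNr; set I := Rintegral _ _ _.
(* The initial parity is the origin of the sign [(-1) ^+ k] in the formula. *)
have -> : (~~ odd k)%:R = 2^-1 * (1 + (-1) ^+ k) :> K.
  by rewrite -signr_odd; case: odd => /=; rewrite ?expr0 ?expr1; field.
(* The product of the two exponentials is isolated so that [eK] can cancel it. *)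
transitivity (expR (- (c * t)) * (2^-1 * (1 + (-1) ^+ k) - 2 * mu / c)
    + 2 * mu / c * (expR (- (c * t)) * expR (c * t))
    + lam * (expR (- (c * t)) * I)).
  by ring.
by rewrite eK /c; field.
Qed.

End tail_moments.

(** * Real limits and extended-real nonnegative series *)

Section nonnegative_series.
Context {K : realType}.
Implicit Types (u : nat -> K) (l : K).

(** A nonnegative series always converges in the extended reals, so a subsequence of partial sums
    identifies its sum. *)
Lemma nneseries_eq_cvg u l (phi : nat -> nat) : (forall n, 0 <= u n) ->
  phi N @[N --> \oo] --> \oo ->
  \sum_(0 <= n < phi N) u n @[N --> \oo] --> l ->
  (\sum_(0 <= n <oo) (u n)%:E = l%:E)%E.
Proof.
move=> u0 phiy ul.
have {}ul : (\sum_(0 <= n < phi N) (u n)%:E)%E @[N --> \oo] --> l%:E.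
  under eq_fun do rewrite sumEFin.
  by apply: cvg_EFin => //; exact: nearW.
have uS : (\sum_(0 <= n < phi N) (u n)%:E)%E @[N --> \oo] -->
    (\sum_(0 <= n <oo) (u n)%:E)%E.
  apply: (cvg_comp phi (fun N => (\sum_(0 <= n < N) (u n)%:E)%E) phiy).
  by apply: is_cvg_nneseries => n _ _; rewrite lee_fin.
exact: (cvg_unique (@ereal_hausdorff _) uS ul).
Qed.

Lemma cvg_nneseriesE u l : (forall n, 0 <= u n) ->
  (\sum_(0 <= n <oo) (u n)%:E = l%:E)%E ->
  \sum_(0 <= n < N) u n @[N --> \oo] --> l.
Proof.
move=> u0 ul.
have : (\sum_(0 <= n < N) (u n)%:E)%E @[N --> \oo] --> l%:E.
  rewrite -ul; apply: is_cvg_nneseries => n _ _; exact: u0.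
under eq_fun do rewrite sumEFin.
by move=> /fine_cvgP[].
Qed.

End nonnegative_series.

(** * Moments of integer-valued random variables *)

Section nat_valued_random_variables.
Context d (T : measurableType d) (K : realType) (P : probability T K).
Variables (Y : {RV P >-> nat}) (p : nat -> K).
Hypothesis pE : forall n, P (Y @^-1` [set n]) = (p n)%:E.

Lemma measurable_nat_event (A : set nat) : measurable (Y @^-1` A).
Proof. exact: measurable_funPTI. Qed.

Lemma probability_nat_lt N :
  P (Y @^-1` [set n | (n < N)%N]) = (\sum_(0 <= n < N) p n)%:E.
Proof.
elim: N => [|N IH].
  rewrite big_nil (_ : _ @^-1` _ = set0) ?measure0//.
  by apply/seteqP; split => w.
rewrite (_ : _ @^-1` _ =
    Y @^-1` [set n | (n < N)%N] `|` Y @^-1` [set N]); last first.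
  apply/seteqP; split => w /=; last by move=> [/ltnW|->].
  by rewrite ltnS leq_eqVlt => /predU1P[|]; [right|left].
rewrite measureU; [|exact: measurable_nat_event..|].
  by rewrite big_nat_recr//= EFinD -IH -pE.
by apply/seteqP; split => w //= -[] /[swap] ->; rewrite ltnn.
Qed.

Lemma probability_nat_ge N :
  P (Y @^-1` [set n | (N <= n)%N]) = (1 - \sum_(0 <= n < N) p n)%:E.
Proof.
rewrite (_ : _ @^-1` _ = ~` (Y @^-1` [set n | (n < N)%N])); last first.
  by apply/seteqP; split => w; rewrite /setC /= (leqNgt N) => /negP.
by rewrite probability_setC ?probability_nat_lt//; exact: measurable_nat_event.
Qed.

(* Integrate the sum over all m of u m * 1_(m < Y) term by term. *)
Lemma expectation_partial_sum (u : nat -> K) : (forall m, 0 <= u m) ->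
  ('E_P[fun w => (\sum_(0 <= m < Y w) u m)%R] =
   \sum_(0 <= m <oo) (u m * (1 - \sum_(0 <= n < m.+1) p n)%R)%:E)%E.
Proof.
move=> u0; rewrite unlock.
pose A m := Y @^-1` [set n | (m < n)%N].
transitivity (\int[P]_w \sum_(0 <= m <oo) ((u m)%:E * (\1_(A m) w)%:E))%E.
  apply: eq_integral => w _; apply/esym/cvg_lim => //.
  (* Terms with index at least [Y w] vanish, so the partial sums are eventually constant. *)
  apply: cvg_near_cst; exists (Y w) => // N /= YN.
  rewrite (big_cat_nat _ YN)//= [X in (_ + X)%E]big1_seq ?adde0; last first.
    move=> m /andP[_]; rewrite mem_index_iota => /andP[Ym _].
    by rewrite indicE memNset ?mule0//= /A/=; apply/negP; rewrite -leqNgt.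
  rewrite -sumEFin; apply: eq_big_nat => m /andP[_ mY].
  by rewrite indicE mem_set ?mule1.
rewrite integral_nneseries//=; last first.
- by move=> m w _; rewrite mule_ge0// lee_fin.
- move=> m; apply: measurable_funeM; apply/measurable_EFinP.
  by apply: measurable_indic; exact: measurable_nat_event.
apply: eq_eseriesr => m _.
rewrite ge0_integralZl//=; last first.
- by rewrite lee_fin.
- by apply/measurable_EFinP/measurable_indic; exact: measurable_nat_event.
rewrite integral_indic//; last exact: measurable_nat_event.
by rewrite setIT EFinM; congr (_ * _)%E; exact: probability_nat_ge m.+1.
Qed.

End nat_valued_random_variables.

(** For nonnegative functions a finite expectation gives integrability, which the covariance formula
    requires of both [X] and its square. *)
Lemma variance_of_moments d (T : measurableType d) (K : realType)
    (P : probability T K) (X : T -> K) (a b : K) :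
  measurable_fun setT X -> (forall w, 0 <= X w) ->
  'E_P[X]%E = a%:E -> ('E_P[fun w => (X w ^+ 2)%R])%E = b%:E ->
  'V_P[X]%E = (b - a ^+ 2)%:E.
Proof.
move=> mX X0 Ea Eb.
have XXE : (X * X = (fun w => X w ^+ 2)).
  by apply/funext => w; rewrite expr2.
have L1 (f : T -> K) c : measurable_fun setT f -> (forall w, 0 <= f w) ->
    'E_P[f]%E = c%:E -> f \in Lfun P 1.
  move=> mf f0; rewrite unlock => Ef; apply/Lfun1_integrable/integrableP; split.
    exact/measurable_EFinP.
  under eq_integral do rewrite /= ger0_norm//.
  by rewrite Ef ltry.
have LX := L1 _ _ mX X0 Ea.
have LXX : X * X \in Lfun P 1.
  rewrite XXE; apply: L1 Eb; last by move=> w; exact: sqr_ge0.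
  exact: measurable_funX.
by rewrite /variance covarianceE// XXE Ea Eb.
Qed.

(** * Derivatives relative to the half-line *)

Section half_line_derivative.
Context {K : realType}.
Implicit Types (f : K -> K) (t l : K).

(** A derivative [l] relative to the half-line bounds nearby increments by [(|l| + 1) |h|], and
    clamping at 0 is 1-Lipschitz. *)
Lemma continuous_maxr0 f :
    (forall t, 0 <= t -> exists l, is_derive_nneg f t l) ->
  continuous (fun t => f (Num.max 0 t)).
Proof.
move=> df t; apply/cvgrPdist_lt => e e0; set m := Num.max 0 t.
have m0 : 0 <= m by rewrite le_max lexx.
have [l /cvgrPdist_lt/(_ _ ltr01)[r /= r0 ball_r]] := df m m0.
have l1 : 0 < `|l| + 1 by rewrite ltr_wpDl.
(* Within [r] the difference quotient is within 1 of [l]; the second bound then keeps the increment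
   below [e]. *)
exists (Num.min r (e / (`|l| + 1))) => /=.
  by rewrite lt_min r0 divr_gt0.
move=> s /=; rewrite lt_min => /andP[str ste].
set h := Num.max 0 s - m.
have sE : Num.max 0 s = m + h by rewrite /h addrC subrK.
have hst : `|h| <= `|t - s|.
  rewrite /h /m distrC; case: (leP 0 s); case: (leP 0 t) => ? ?;
    rewrite ?subrr ?normr0 ?normr_ge0// ?subr0 ?sub0r ?normrN.
  - by rewrite ger0_norm// ler_normr; apply/orP; right; rewrite opprB; lra.
  - by rewrite ger0_norm// ler_normr; apply/orP; left; lra.
rewrite sE; have [->|h0] := eqVneq h 0; first by rewrite addr0 subrr normr0.
have : `|l - h^-1 * (f (m + h) - f m)| < 1.
  apply: ball_r => //=; first by rewrite /= sub0r normrN (le_lt_trans hst).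
  by rewrite -sE le_max lexx.
move=> lh; have : `|h^-1 * (f (m + h) - f m)| < `|l| + 1.
  rewrite -ltrBlDl; apply: le_lt_trans lh.
  by rewrite distrC; apply: lerB_dist.
rewrite normrM normfV mulrC ltr_pdivrMr ?normr_gt0// distrC => /lt_trans; apply.
by rewrite mulrC -ltr_pdivlMr// (le_lt_trans hst).
Qed.

(** Around a positive time, small shifts stay nonnegative, so both the clamp and the restriction to
    the half-line are eventually invisible. *)
Lemma is_derive_maxr0 f t l : 0 < t -> is_derive_nneg f t l ->
  is_derive t 1 (fun s => f (Num.max 0 s)) l.
Proof.
move=> t0 dft.
have tmax : Num.max 0 t = t by apply/max_idPr/ltW.
have h : h^-1 *: (((fun s => f (Num.max 0 s)) \o shift t) (h *: (1 : K))
    - f (Num.max 0 t)) @[h --> 0^'] --> l.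
  rewrite tmax; apply/cvgrPdist_lt => e e0.
  have /cvgrPdist_lt/(_ e e0) := dft; rewrite near_withinE => dfte.
  have th_ge0 : \forall h \near (0 : K)^', 0 <= t + h.
    apply: nbhs_dnbhs; exists t => //= h /=; rewrite sub0r normrN => ht.
    by have := ler_norm (- h); rewrite normrN; lra.
  apply: filterS2 th_ge0 dfte => h th0 /(_ th0).
  have thmax : Num.max 0 (t + h) = t + h by apply/max_idPr.
  by rewrite /= [h *: 1]mulr1 [h + t]addrC thmax.
split.
  by apply/cvg_ex; exists l.
by apply: cvg_lim.
Qed.

End half_line_derivative.

(** * From the Markov chain to the flux equations and the moments *)

Lemma forward_equations_flux (K : realType) (lam mu : K) q k n (t : K) :
  forward_equations lam mu q -> 0 <= t ->
  is_derive_nneg (q k n) t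
    (flux lam mu (q k) n t - flux lam mu (q k) n.+1 t).
Proof.
move=> [fe0 feE feO] t0; have [n_odd|] := boolP (odd n).
  have [m ->] : exists m, n = m.+1.*2.-1 by exists n./2; lia.
  rewrite (_ : _ - _ = lam * q k m.+1.*2 t - 2 * mu * q k m.+1.*2.-1 t
    + lam * q k m.+1.*2.-2 t); first exact: feO.
  by rewrite /flux doubleS /= /rate /= odd_double /=; ring.
case: n => [_|n n_even].
  rewrite (_ : _ - _ = mu * q k 1 t - lam * q k 0 t); first exact: fe0.
  by rewrite /flux /rate /=; ring.
have [m ->] : exists m, n.+1 = m.+1.*2 by exists n./2; lia.
rewrite (_ : _ - _ = mu * q k m.+1.*2.-1 t - 2 * lam * q k m.+1.*2 t
  + mu * q k m.+1.*2.+1 t); first exact: feE.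
by rewrite /flux doubleS /= /rate /= odd_double /=; ring.
Qed.

(** The Markov property at the two instants 0 and [t], divided by the positive probability of
    starting at [k]. *)
Lemma cond_law_fiber d (T : measurableType d) (K : realType) (lam mu : K)
    (P : probability T K) (R : K -> {RV P >-> nat}) q k (t : K) n :
    alternating_birth_death lam mu R q ->
    (0 < P (R 0%R @^-1` [set k]))%E -> 0 <= t ->
  cond_law (R 0) k (R t @^-1` [set n]) = (q k n t)%:E.
Proof.
move=> [_ _ Rm] Pk t0.
have Pfin : P (R 0 @^-1` [set k]) \is a fin_num.
  by apply: fin_num_measure; exact: measurable_fiber.
pose s j : K := if j is 0%N then 0 else t.
pose i j : nat := if j is 0%N then k else n.
have s_homo : {homo s : a b / (a <= b)%N >-> a <= b}.
  by move=> [|a] [|b].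
have := Rm 0%N s i (lexx _) s_homo.
rewrite (_ : \bigcap_(j in [set j | (j <= 1)%N]) _ =
    R t @^-1` [set n] `&` R 0 @^-1` [set k]); last first.
  apply/seteqP; split=> w.
    by move=> h; split; [exact: (h 1%N)|exact: (h 0%N)].
  by move=> [h1 h0] [|[|//]].
rewrite (_ : \bigcap_(j in [set j | (j <= 0)%N]) _ =
    R 0 @^-1` [set k]); last first.
  by apply/seteqP; split=> w; [move=> /(_ 0%N); exact|move=> h [|//]].
rewrite /= subr0 => PE.
rewrite /cond_law /= /mnormalize /= /mrestr setTI.
(* The fallback of the normalization concerns mass zero or infinite; both are excluded. *)
rewrite gt_eqF//=; case: ifPn => [/eqP Poo|_].
  by move: Pfin; rewrite Poo.
rewrite PE -(fineK Pfin) -!EFinM mulrAC divff ?mul1r//.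
by rewrite gt_eqF// fine_gt0// Pk ltey_eq Pfin.
Qed.

Theorem proposition4 (d : measure_display) (T : measurableType d)
    (K : realType) (lam mu : K) (P : probability T K)
    (R : K -> {RV P >-> nat}) (q : nat -> nat -> K -> K)
    (lam_gt0 : 0 < lam) (mu_gt0 : 0 < mu)
    (HR : alternating_birth_death lam mu R q)
    (k : nat) (Hk : (0 < P (R 0%R @^-1` [set k]))%E) :
  let Pr_k : probability T K := cond_law (R 0) k in
  let P_k (t : K) : K := fine (Pr_k [set w | ~~ odd (R t w)]) in
  let I_k (t : K) : K :=
    (\int[lebesgue_measure]_(tau in `[0%R, t]) q k 0%N tau)%R in
  forall t : K, 0 <= t ->
  [/\ (forall n : nat, Pr_k (R t @^-1` [set n]) = (q k n t)%:E),
      (P_k t)%:E = (\sum_(0 <= n <oo) (q k n.*2 t)%:E)%E,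
      'E_Pr_k[fun w => (R t w)%:R%R]%E = (lam * I_k t + k%:R)%:E,
      'V_Pr_k[fun w => (R t w)%:R%R]%E =
        (2 * (lam - mu) * (\int[lebesgue_measure]_(tau in `[0%R, t]) P_k tau)%R
         - lam * (2 * k%:R + 1) * I_k t
         - lam ^+ 2 * (I_k t) ^+ 2 + 2 * mu * t)%:E
    & P_k t =
        2^-1 * (2 * mu / (lam + mu)
                + ((lam - mu) / (lam + mu) + (-1) ^+ k)
                  * expR (- 2 * (lam + mu) * t))
        + lam * (\int[lebesgue_measure]_(tau in `[0%R, t])
                   (expR (- 2 * (lam + mu) * (t - tau)) * q k 0%N tau))%R].
Proof.
move=> Pr_k P_k I_k.
have [[q_ge0 q_sum q_init _] qF _] := HR.
have PrE s n : 0 <= s -> Pr_k (R s @^-1` [set n]) = (q k n s)%:E.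
  by move=> s0; exact: cond_law_fiber HR Hk s0.
have evenE s : 0 <= s ->
    (P_k s)%:E = (\sum_(0 <= n <oo) (q k n.*2 s)%:E)%E.
  move=> s0; rewrite fineK; last first.
    apply: fin_num_measure.
    exact: (measurable_nat_event (P := Pr_k) (R s) [set n | ~~ odd n]).
  (* Countable additivity applies over the even values, whose fibers are disjoint because doubling
     is injective. *)
  rewrite (_ : [set w | _] = \bigcup_n R s @^-1` [set n.*2]); last first.
    apply/seteqP; split=> w /= => [Rw|[n _ ->]]; last by rewrite odd_double.
    by exists (R s w)./2 => //=; lia.
  rewrite measure_bigcup//; last 2 first.
  - by move=> n _; exact: measurable_nat_event.
  - by move=> i j _ _ [w [/= -> /double_inj]].
  rewrite (eq_eseriesl (Q := xpredT)); last by move=> n; rewrite in_setT.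
  by apply: eq_eseriesr => n _; exact: PrE.
(* Extending q constantly to negative times makes one-sided continuity at 0
   two-sided. *)
pose Q n s := q k n (Num.max 0 s).
have QE n s : 0 <= s -> Q n s = q k n s by move=> s0; rewrite /Q (max_idPr s0).
have cQ n : continuous (Q n).
  apply: continuous_maxr0 => s s0; eexists.
  exact: forward_equations_flux qF s0.
have dQ n (s : K) : 0 < s ->
    is_derive s 1 (Q n) (flux lam mu Q n s - flux lam mu Q n.+1 s).
  move=> s0; have -> : flux lam mu Q n s - flux lam mu Q n.+1 s =
      flux lam mu (q k) n s - flux lam mu (q k) n.+1 s.
    by rewrite /flux; case: n => [|n]; rewrite !QE ?ltW.
  exact/is_derive_maxr0/forward_equations_flux/ltW.
have Q_ge0 n s : 0 <= Q n s by apply: q_ge0; rewrite le_max lexx.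
have sumQ s : \sum_(0 <= n < N) Q n s @[N --> \oo] --> (1 : K).
  by apply: cvg_nneseriesE => //; apply: q_sum; rewrite le_max lexx.
have Q_init n : Q n 0 = (n == k)%:R by rewrite QE ?q_init.
have P_cvg s : 0 <= s -> even_mass Q N s @[N --> \oo] --> P_k s.
  move=> s0; rewrite /even_mass.
  (* [even_mass] has [N.+1] terms, hence the shift by one. *)
  rewrite (cvg_shiftS (fun N => \sum_(0 <= n < N) Q n.*2 s)).
  apply: cvg_nneseriesE => //; rewrite evenE//.
  by apply: eq_eseriesr => n _; rewrite QE.
move=> t t0.
have tail1 N s : 0 <= 1 - \sum_(0 <= n < N) Q n s.
  exact: tail_ge0 Q_ge0 sumQ N s.
have IE : I_k t = \int[lebesgue_measure]_(x in `[0, t]) Q 0%N x.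
  apply: eq_Rintegral => x.
  by rewrite inE/= in_itv/= => /andP[x0 _]; rewrite QE.
have pE n : Pr_k (R t @^-1` [set n]) = (Q n t)%:E by rewrite QE// PrE.
have RE : 'E_Pr_k[fun w => (R t w)%:R%R]%E = (lam * I_k t + k%:R)%:E.
  rewrite (_ : (fun w => _) = (fun w => \sum_(0 <= m < R t w) 1)); last first.
    by apply/funext => w; rewrite sumr_const_nat subn0.
  rewrite (expectation_partial_sum pE)//.
  apply: (nneseries_eq_cvg (phi := id)) => //.
    by move=> m; rewrite mul1r tail1.
  rewrite IE addrC; under eq_fun do under eq_bigr do rewrite mul1r.
  exact: moment1_cvg lam_gt0 mu_gt0 cQ dQ Q_ge0 sumQ Q_init t t0.
have R2E : 'E_Pr_k[fun w => ((R t w)%:R ^+ 2)%R]%E =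
    (k%:R ^+ 2 + (2 * (lam - mu) * \int[lebesgue_measure]_(x in `[0, t]) P_k x +
      2 * mu * t - lam * I_k t))%:E.
  (* A square is the sum of the first odd numbers, which yields the weights of [moment2]. *)
  rewrite (_ : (fun w => _) =
    (fun w => \sum_(0 <= m < R t w) (2 * m%:R + 1 : K))); last first.
    apply/funext => w; elim: (R t w) => [|n IH].
      by rewrite big_nil expr0n.
    by rewrite big_nat_recr//= -IH -natr1; ring.
  rewrite (expectation_partial_sum pE); last first.
    by move=> m; rewrite addr_ge0// mulr_ge0.
  apply: (nneseries_eq_cvg (phi := fun N => N.*2.+1));
    [|exact: double_succ_cvgy|].
    by move=> m; rewrite mulr_ge0 ?tail1// addr_ge0// mulr_ge0.
  rewrite IE.
  exact: moment2_cvg lam_gt0 mu_gt0 cQ dQ Q_ge0 sumQ Q_init P_k P_cvg t t0.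
split.
- by move=> n; exact: PrE.
- exact: evenE.
- exact: RE.
- rewrite (variance_of_moments _ _ RE R2E)//.
  (* Subtracting the squared mean cancels [k ^ 2], and its cross term turns [lam] into
     [lam * (2k + 1)]. *)
  + by congr EFin; ring.
  + move=> mT A mA; rewrite setTI.
    exact: (measurable_nat_event (P := Pr_k) (R t) ((fun n => n%:R) @^-1` A)).
- rewrite (even_prob_formula lam_gt0 mu_gt0 cQ dQ Q_ge0 sumQ Q_init P_cvg t0).
  congr (_ + lam * _); apply: eq_Rintegral => x.
  by rewrite inE/= in_itv/= => /andP[x0 _]; rewrite QE.
Qed.
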